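(* Let $d\ge1$ and let $\{a_\alpha\}_{\alpha\in\mathbb{N}_0^d}\subset\mathbb{R}\cup\{\pm\infty\}$ satisfy: (i) $a_\alpha>-\infty$ for all $\alpha\in\mathbb{N}_0^d$; (ii) $\lim_{|\alpha|\to+\infty}a_\alpha/|\alpha|=+\infty$; (iii) $a_\alpha=+\infty$ for at most finitely many $\alpha\in\mathbb{N}_0^d$; (iv) $a_0\in\mathbb{R}$. Then the convex minorant sequence $\{a^c_\alpha\}_{\alpha\in\mathbb{N}_0^d}$ of $\{a_\alpha\}_{\alpha\in\mathbb{N}_0^d}$ is given by $$a^c_\alpha=F(\alpha),\qquad \alpha\in\mathbb{N}_0^d,$$ where $F(x):=\sup_{f\in\mathcal{L}_S}f(x)$ and $\mathcal{L}_S$ is the set of affine functions $f:\mathbb{R}^d\to\mathbb{R}$ with $f(\beta)\le a_\beta$ for all $\beta\in\mathbb{N}_0^d$; or equivalently by $$a^c_\alpha=\sup_{k\in\mathbb{R}^d}\left(\langle k,\alpha\rangle+h_k\right),\qquad\text{where } h_k=\inf_{\beta\in\mathbb{N}_0^d}\left(a_\beta-\langle k,\beta\rangle\right).$$ In particular $a^c_0=a_0$.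
   Context: $\mathbb{N}_0=\mathbb{N}\cup\{0\}$ and $|\alpha|=\alpha_1+\cdots+\alpha_d$ for $\alpha\in\mathbb{N}_0^d$. Affine functions on $\mathbb{R}^d$ are those of the form $f(x)=\langle k,x\rangle+c$ with $k\in\mathbb{R}^d$, $c\in\mathbb{R}$. A real sequence $\{b_\alpha\}_{\alpha\in\mathbb{N}_0^d}$ is called convex if there exists a convex function $G:[0,+\infty)^d\to\mathbb{R}$ with $G(\alpha)=b_\alpha$ for all $\alpha\in\mathbb{N}_0^d$. The convex minorant of a sequence $\{a_\alpha\}_{\alpha\in\mathbb{N}_0^d}$ is the largest (term by term) convex sequence $\{a^c_\alpha\}_{\alpha\in\mathbb{N}_0^d}$ with $a^c_\alpha\le a_\alpha$ for all $\alpha\in\mathbb{N}_0^d$. *)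

(* Defs.v *)
From mathcomp Require Import all_boot all_order all_algebra.
From mathcomp Require Import all_classical all_reals all_analysis.

Set Implicit Arguments.
Unset Strict Implicit.
Unset Printing Implicit Defensive.

Import Order.TTheory GRing.Theory Num.Theory.

Local Open Scope classical_set_scope.
Local Open Scope ring_scope.

(* Multi-indices in N_0^d are rows of natural numbers, 'rV[nat]_d. *)

Definition mabs (d : nat) (alpha : 'rV[nat]_d) : nat :=
  (\sum_(i < d) alpha ord0 i)%N.

(* The filter "|alpha| --> +oo" on N_0^d. *)
Definition mabs_infty (d : nat) : set_system 'rV[nat]_d :=
  filter_from [set: nat] (fun n => [set alpha | (n <= mabs alpha)%N]).

Arguments mabs_infty : clear implicits.

Global Instance mabs_infty_filter (d : nat) : Filter (mabs_infty d).
Proof.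
apply: filter_from_filter; first by exists 0%N.
move=> m n _ _; exists (maxn m n) => // alpha /=.
by rewrite geq_max => /andP[].
Qed.

Definition mi_vec (R : realType) (d : nat) (alpha : 'rV[nat]_d) : 'rV[R]_d :=
  \row_(i < d) (alpha ord0 i)%:R.

Arguments mi_vec R {d} alpha.

Definition dotp (R : realType) (d : nat) (k x : 'rV[R]_d) : R :=
  \sum_(i < d) k ord0 i * x ord0 i.

Definition orthant (R : realType) (d : nat) : set 'rV[R]_d :=
  [set x | forall i, 0 <= x ord0 i].

Arguments orthant : clear implicits.

(* G is total, but only its values on the orthant are constrained. *)
Definition convex_seq (R : realType) (d : nat) (b : 'rV[nat]_d -> R) : Prop :=
  exists G : 'rV[R]_d -> R,
    convex_function (orthant R d) G /\
    forall alpha, G (mi_vec R alpha) = b alpha.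

Definition is_convex_minorant (R : realType) (d : nat)
    (a : 'rV[nat]_d -> \bar R) (c : 'rV[nat]_d -> R) : Prop :=
  [/\ convex_seq c,
      forall alpha, ((c alpha)%:E <= a alpha)%E &
      forall b : 'rV[nat]_d -> R, convex_seq b ->
        (forall alpha, ((b alpha)%:E <= a alpha)%E) ->
        forall alpha, b alpha <= c alpha].

Definition affine_fun (R : realType) (d : nat) (f : 'rV[R]_d -> R) : Prop :=
  exists (k : 'rV[R]_d) (c : R), forall x, f x = dotp k x + c.

Definition affine_minorants (R : realType) (d : nat)
    (a : 'rV[nat]_d -> \bar R) : set ('rV[R]_d -> R) :=
  [set f | affine_fun f /\ forall beta, ((f (mi_vec R beta))%:E <= a beta)%E].

Definition affine_envelope (R : realType) (d : nat)
    (a : 'rV[nat]_d -> \bar R) (x : 'rV[R]_d) : \bar R :=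
  ereal_sup [set (f x)%:E | f in affine_minorants a].

Definition hinf (R : realType) (d : nat)
    (a : 'rV[nat]_d -> \bar R) (k : 'rV[R]_d) : \bar R :=
  ereal_inf [set (a beta - (dotp k (mi_vec R beta))%:E)%E
            | beta in [set: 'rV[nat]_d]].

(* Main.v *)
Require Import Defs.
From mathcomp Require Import all_boot all_order all_algebra.
From mathcomp Require Import all_classical all_reals all_analysis.
From mathcomp Require Import ring lra.

(** The affine envelope F is a supremum of affine functions below a, so, once
    it is known to be finite on the orthant, its restriction to N_0^d is a
    convex sequence below a.  The substance of the theorem is that no convex
    sequence below a exceeds F
    ([affine_minorant_touching_convex_seq]): given b <= a with convex extension
    G and a multi-index alpha, some affine function lies below a on all of
    N_0^d and takes the value b alpha at alpha.

    A supporting hyperplane of G at alpha need not exist when alpha lies on the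
    boundary of the orthant, where G may have infinite slope.  But only the
    lattice points matter, and by superlinearity only finitely many of them:

    - For finitely many points of the orthant there is always a slope k
      supporting G at alpha on these points ([finite_subgradient]).  This is a
      system of finitely many linear inequalities; all of them belong to the
      convex cone spanned by the epigraph of G seen from (alpha, G alpha), and
      that cone contains no contradictory inequality, so that Fourier-Motzkin
      elimination solves the system ([cone_system_solvable]).

    - If the neighbours alpha + e_i are among the points, every coordinate of k
      is bounded above by some K that depends only on b, although it may be
      arbitrarily negative; if 0 is among them, the value of the affine function
      at 0 is at most b 0.  At multi-indices beta the affine function is then at
      most b 0 + K |beta|, which is below a as soon as |beta| is large.  As K is
      known before the finite set is chosen, that set can be taken to contain
      the remaining multi-indices.

    Finiteness of F ([affine_envelope_fin_num]) comes from above by writing a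
    point of the orthant as a convex combination of 0 and of far away points
    M e_i, where a is finite, and from below by the minorant a_0 - K |x|, with
    K large.  This minorant equals a_0 at 0, which also gives F(0) = a_0
    ([affine_minorant_at0]).  The formula with h_k holds because h_k is the
    largest constant c for which <k, x> + c lies below a
    ([affine_envelope_hinf]). *)

Set Implicit Arguments.
Unset Strict Implicit.
Unset Printing Implicit Defensive.

Import Order.TTheory GRing.Theory Num.Theory.

Local Open Scope classical_set_scope.
Local Open Scope ring_scope.

(** * The scalar product *)

Section Dotp.
Variables (R : realType) (d : nat).
Implicit Types (k l x y : 'rV[R]_d) (t : R).

Lemma dotpDl k l x : dotp (k + l) x = dotp k x + dotp l x.
Proof. by rewrite -big_split; apply: eq_bigr => i _; rewrite mxE mulrDl. Qed.

Lemma dotpDr k x y : dotp k (x + y) = dotp k x + dotp k y.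
Proof. by rewrite -big_split; apply: eq_bigr => i _; rewrite mxE mulrDr. Qed.

Lemma dotpZr t k x : dotp k (t *: x) = t * dotp k x.
Proof. by rewrite /dotp mulr_sumr; apply: eq_bigr => i _; rewrite mxE mulrCA. Qed.

Lemma dotpNr k x : dotp k (- x) = - dotp k x.
Proof. by rewrite -scaleN1r dotpZr mulN1r. Qed.

Lemma dotpBr k x y : dotp k (x - y) = dotp k x - dotp k y.
Proof. by rewrite dotpDr dotpNr. Qed.

Lemma dotp0r k : dotp k 0 = 0.
Proof. by apply: big1 => i _; rewrite mxE mulr0. Qed.

Lemma dotp_deltar k i : dotp k (delta_mx 0 i) = k 0 i.
Proof.
rewrite /dotp (bigD1 i)//= big1 ?addr0; first by rewrite mxE !eqxx mulr1.
by move=> j /negPf ji; rewrite mxE ji andbF mulr0.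
Qed.

Lemma dotp_deltal t i x : dotp (t *: delta_mx 0 i) x = t * x 0 i.
Proof.
rewrite /dotp (bigD1 i)//= big1 ?addr0; first by rewrite !mxE !eqxx mulr1.
by move=> j /negPf ji; rewrite !mxE ji andbF mulr0 mul0r.
Qed.

End Dotp.

(** * Finite systems of linear inequalities *)

Lemma seq_separation (R : realDomainType) (L U : seq R) :
  {in L & U, forall l u, l <= u} ->
  exists t, {in L, forall l, l <= t} /\ {in U, forall u, t <= u}.
Proof.
elim: L => [_|l L IHL LU].
  elim: U => [|u U [t [_ tU]]]; first by exists 0.
  exists (Num.min u t); split=> // v; rewrite inE => /predU1P[->|/tU tv].
    by rewrite ge_min lexx.
  by rewrite ge_min tv orbT.
have [|t [Lt tU]] := IHL; first by move=> l' u Ll'; apply: LU; rewrite inE Ll' orbT.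
exists (Num.max l t); split=> [l'|u Uu].
  rewrite inE => /predU1P[->|/Lt l't]; first by rewrite le_max lexx.
  by rewrite le_max l't orbT.
by rewrite ge_max tU// LU// mem_head.
Qed.

(** A form of Farkas' lemma.  A pair (u, r) stands for the inequality
    <k, u> <= r in the unknown k, and C for a set of inequalities closed under
    nonnegative combinations, so that C contains a contradiction exactly when
    it contains some (0, r) with r < 0.  Fourier-Motzkin elimination combines
    inequalities of C without leaving C, so a single cone serves throughout the
    induction.  Only finite subsystems are solved: C as a whole may have no
    solution. *)
Lemma cone_system_solvable (R : realType) (d : nat) (C : 'rV[R]_d -> R -> Prop) :
  (forall a b u v r s, 0 <= a -> 0 <= b -> C u r -> C v s ->
     C (a *: u + b *: v) (a * r + b * s)) ->
  (forall r, C 0 r -> 0 <= r) ->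
  forall s : seq ('rV[R]_d * R), {in s, forall p, C p.1 p.2} ->
  exists k, {in s, forall p, dotp k p.1 <= p.2}.
Proof.
move=> Ccomb C0.
(* Induction on the number m of leading coordinates still occurring in s. *)
suff elim_coord m (s : seq ('rV[R]_d * R)) : {in s, forall p, C p.1 p.2} ->
    (forall p, p \in s -> forall i : 'I_d, (m <= i)%N -> p.1 0 i = 0) ->
    exists k, {in s, forall p, dotp k p.1 <= p.2}.
  by move=> s sC; apply: (elim_coord d) => // p _ i; rewrite leqNgt ltn_ord.
elim: m s => [|m IHm] s sC s0.
  exists 0 => p sp; have p0 : p.1 = 0.
    by apply/rowP => i; rewrite (s0 p sp i) ?mxE.
  by rewrite p0 dotp0r; apply: C0; rewrite -p0; exact: sC.
have [dm|md] := leqP d m.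
  by apply: IHm => // p _ i mi; have := leq_trans dm mi; rewrite leqNgt ltn_ord.
pose j := Ordinal md.
pose pos := [seq p : 'rV[R]_d * R <- s | 0 < p.1 0 j]; pose neg := [seq p : 'rV[R]_d * R <- s | p.1 0 j < 0].
(* The positive combination of p and q in which coordinate j cancels. *)
pose comb (p q : 'rV[R]_d * R) :=
  (- q.1 0 j *: p.1 + p.1 0 j *: q.1, - q.1 0 j * p.2 + p.1 0 j * q.2).
pose s' := [seq p : 'rV[R]_d * R <- s | p.1 0 j == 0] ++ [seq comb p q | p <- pos, q <- neg].
have [p|p|y ys'] := IHm s'.
- rewrite mem_cat mem_filter => /orP[/andP[_ /sC]//|].
  move=> /allpairsP[[q r] /= []]; rewrite !mem_filter => /andP[q0 sq] /andP[r0 sr] ->.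
  by apply: Ccomb; [rewrite oppr_ge0 ltW|exact: ltW|exact: sC|exact: sC].
- rewrite mem_cat mem_filter => /orP[/andP[/eqP pj sp] i mi|].
    have [ji|ij] := eqVneq j i; first by rewrite -ji.
    by apply: s0 => //; rewrite ltn_neqAle mi andbT.
  move=> /allpairsP[[q r] /= []]; rewrite !mem_filter => /andP[q0 sq] /andP[r0 sr] -> i mi.
  rewrite !mxE; have [<-|ij] := eqVneq j i; first by ring.
  have mi' : (m < i)%N by rewrite ltn_neqAle mi andbT.
  by rewrite (s0 q sq i mi') (s0 r sr i mi') !mulr0 addr0.
(* With the other coordinates of the solution set to those of y, an inequality
   p bounds coordinate j, relative to y, by slack p: from above if p.1 0 j is
   positive, from below if it is negative. *)
pose slack (p : 'rV[R]_d * R) := (p.2 - dotp y p.1) / p.1 0 j.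
have [|t [Lt tU]] := @seq_separation R (map slack neg) (map slack pos).
  move=> _ _ /mapP[q nq ->] /mapP[p pp ->]; rewrite /slack.
  have := ys' (comb p q); rewrite mem_cat allpairs_f ?orbT//= => /(_ isT).
  move: nq pp; rewrite !mem_filter => /andP[q0 _] /andP[p0 _].
  rewrite dotpDr !dotpZr ler_ndivrMr// mulrAC ler_pdivrMr//.
  by move: (dotp y p.1) (dotp y q.1) => yp yq; lra.
exists (y + t *: delta_mx 0 j) => p sp; rewrite dotpDl dotp_deltal.
have [p0|p0|p0] := ltgtP (p.1 0 j) 0.
- have /Lt : slack p \in map slack neg by apply: map_f; rewrite mem_filter p0.
  by rewrite /slack ler_ndivrMr//; lra.
- have /tU : slack p \in map slack pos by apply: map_f; rewrite mem_filter p0.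
  by rewrite /slack ler_pdivlMr//; lra.
- by rewrite p0 mulr0 addr0 ys'// mem_cat mem_filter p0 eqxx sp.
Qed.

(** * Supporting a convex function at finitely many points *)

(** Convexity in homogeneous form: weights need not add up to 1 and may all
    vanish, as is needed to add elements of the cone spanned by an epigraph. *)
Lemma convex_orthant_comb (R : realType) (d : nat) (G : 'rV[R]_d -> R) (p q : R)
    (x y : 'rV[R]_d) :
  convex_function (orthant R d) G -> 0 <= p -> 0 <= q ->
  orthant R d x -> orthant R d y ->
  exists z, [/\ orthant R d z, (p + q) *: z = p *: x + q *: y &
                (p + q) * G z <= p * G x + q * G y].
Proof.
move=> Gconv p0 q0 x0 y0; have [pq0|pq_neq0] := eqVneq (p + q) 0.
  exists x; have [-> ->] : p = 0 /\ q = 0 by split; lra.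
  by rewrite !addr0 !scale0r !mul0r !addr0.
have pq_gt0 : 0 < p + q by rewrite lt_neqAle eq_sym pq_neq0 addr_ge0.
have t0 : 0 <= p / (p + q) by rewrite divr_ge0// ltW.
have t1 : p / (p + q) <= 1 by rewrite ler_pdivrMr// mul1r lerDl.
have tE : (p + q) * (p / (p + q)) = p by rewrite mulrC divfK.
have tE' : (p + q) * (1 - p / (p + q)) = q by rewrite mulrBr tE; ring.
exists ((p / (p + q)) *: x + (1 - p / (p + q)) *: y); split.
- by move=> i; rewrite !mxE addr_ge0// mulr_ge0// subr_ge0.
- by rewrite scalerDr !scalerA tE tE'.
- have := Gconv (Itv01 t0 t1) x y; rewrite !inE => /(_ x0 y0).
  rewrite convRE /= => /(ler_wpM2l (ltW pq_gt0)).
  rewrite [X in _ <= X -> _]mulrDr [X in _ <= X + _]mulrA tE.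
  by rewrite [X in _ <= _ + X]mulrA tE'.
Qed.

(** On infinitely many points this fails: the convex function - sqrt x on
    [0, +oo[ has no subgradient at 0. *)
Lemma finite_subgradient (R : realType) (d : nat) (G : 'rV[R]_d -> R)
    (x0 : 'rV[R]_d) (s : seq 'rV[R]_d) :
  convex_function (orthant R d) G -> orthant R d x0 ->
  (forall x, x \in s -> orthant R d x) ->
  exists k, forall x, x \in s -> G x0 + dotp k (x - x0) <= G x.
Proof.
move=> Gconv ox0 os.
(* The cone spanned by the epigraph of G translated so that (x0, G x0) becomes
   the origin.  Over u = 0 either nu = 0 or x = x0, whence r >= 0. *)
pose C (u : 'rV[R]_d) (r : R) := exists nu x,
  [/\ 0 <= nu, orthant R d x, u = nu *: (x - x0) & nu * (G x - G x0) <= r].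
have [|||k kP] := @cone_system_solvable R d C _ _ [seq (x - x0, G x - G x0) | x <- s].
- move=> a b _ _ r1 r2 a0 b0 [nu [x [nu0 ox -> le1]]] [mu [y [mu0 oy -> le2]]].
  have [z [oz zE Gz]] := convex_orthant_comb Gconv (mulr_ge0 a0 nu0) (mulr_ge0 b0 mu0) ox oy.
  exists (a * nu + b * mu), z; split=> //.
  + by rewrite addr_ge0// mulr_ge0.
  + by rewrite [RHS]scalerBr zE !scalerA !scalerBr scalerDl opprD addrACA.
  + have := ler_wpM2l a0 le1; have := ler_wpM2l b0 le2; lra.
- move=> r [nu [x [nu0 ox /esym/eqP]]].
  rewrite scaler_eq0 => /orP[/eqP ->|]; first by rewrite mul0r.
  by rewrite subr_eq0 => /eqP ->; rewrite subrr mulr0.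
- move=> p /mapP[x sx ->] /=; exists 1, x; rewrite scale1r mul1r; split=> //.
  exact: os.
exists k => x sx; have /= := kP _ (map_f (fun x => (x - x0, G x - G x0)) sx); lra.
Qed.

(** * Multi-indices *)

Section MultiIndices.
Variables (R : realType) (d : nat).
Implicit Types (alpha beta : 'rV[nat]_d) (k : 'rV[R]_d) (K : R).

Lemma orthant_mi_vec alpha : orthant R d (mi_vec R alpha).
Proof. by move=> i; rewrite mxE ler0n. Qed.

Lemma mi_vec0 : mi_vec R (0 : 'rV[nat]_d) = 0.
Proof. by apply/rowP => i; rewrite !mxE. Qed.

Lemma mabs_eq0 alpha : (mabs alpha == 0)%N = (alpha == 0).
Proof.
apply/idP/eqP => [|->]; last by rewrite /mabs big1// => i _; rewrite mxE.
rewrite sum_nat_eq0 => /forallP alpha0; apply/rowP => i; rewrite mxE.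
exact/eqP/(alpha0 i).
Qed.

Lemma coord_le_mabs alpha i : (alpha ord0 i <= mabs alpha)%N.
Proof. by rewrite /mabs (bigD1 i)//= leq_addr. Qed.

(** The multi-index alpha + n e_i. *)
Definition mi_step alpha (n : nat) (i : 'I_d) : 'rV[nat]_d :=
  \row_j (alpha ord0 j + n * (j == i))%N.

Lemma mi_vec_step alpha n i :
  mi_vec R (mi_step alpha n i) = mi_vec R alpha + n%:R *: delta_mx 0 i.
Proof. by apply/rowP => j; rewrite !mxE natrD natrM. Qed.

Lemma leq_mabs_step alpha n i : (n <= mabs (mi_step alpha n i))%N.
Proof.
apply: leq_trans (coord_le_mabs _ i).
by rewrite mxE eqxx muln1 leq_addl.
Qed.

Lemma dotp_const_mi_vec K beta :
  dotp (const_mx K) (mi_vec R beta) = K * (mabs beta)%:R.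
Proof.
by rewrite /dotp /mabs natr_sum mulr_sumr; apply: eq_bigr => i _; rewrite !mxE.
Qed.

Lemma dotp_mi_vec_le k K beta :
  (forall i, k 0 i <= K) -> dotp k (mi_vec R beta) <= K * (mabs beta)%:R.
Proof.
move=> kK; rewrite -dotp_const_mi_vec; apply: ler_sum => i _.
by rewrite !mxE ler_wpM2r.
Qed.

Lemma mabs_ball_finite N : exists s : seq 'rV[nat]_d,
  forall beta, (mabs beta <= N)%N -> beta \in s.
Proof.
exists [seq map_mx val M | M <- enum {: 'rV['I_N.+1]_d}] => beta betaN.
apply/mapP; exists (map_mx inord beta); rewrite ?mem_enum//.
apply/rowP => i; rewrite !mxE /= inordK// ltnS.
exact: leq_trans (coord_le_mabs _ i) betaN.
Qed.

End MultiIndices.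

Lemma ler_term_sum (R : numDomainType) (I : eqType) (s : seq I) (F : I -> R) i :
  (forall j, 0 <= F j) -> i \in s -> F i <= \sum_(j <- s) F j.
Proof. by move=> F0 si; rewrite (big_rem i)//= lerDl sumr_ge0. Qed.

(** * Affine minorants of a superlinear sequence *)

(** The limit of a_beta / |beta| being +oo, free of the quotient and hence of
    its value at beta = 0. *)
Definition superlinear (R : realType) (d : nat) (a : 'rV[nat]_d -> \bar R) :=
  forall K : R, exists N, forall beta, (N <= mabs beta)%N ->
    ((K * (mabs beta)%:R)%:E <= a beta)%E.

Lemma cvg_superlinear (R : realType) (d : nat) (a : 'rV[nat]_d -> \bar R) :
  ((fun alpha => a alpha / ((mabs alpha)%:R)%:E)%E @ mabs_infty d --> +oo%E) ->
  superlinear a.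
Proof.
move=> /cvgeyPge a_ge K; have [N _ aN] := a_ge K.
exists N.+1 => beta betaN; have := aN beta (ltnW betaN).
have beta_gt0 : 0 < (mabs beta)%:R :> R by rewrite ltr0n (leq_trans _ betaN).
by rewrite /= inver gt_eqF// lee_pdivlMr// EFinM.
Qed.

Section Minorants.
Variables (R : realType) (d : nat) (a : 'rV[nat]_d -> \bar R).
Hypothesis a_superlin : superlinear a.

(** The minorant is a_0 - K (x_1 + ... + x_d).  For large |beta| superlinearity
    alone puts it below a; the finitely many other beta are handled by the
    choice of K, since |beta| >= 1 unless beta = 0. *)
Lemma affine_minorant_at0 : (forall alpha, -oo < a alpha)%E ->
  a 0 \is a fin_num ->
  exists2 f, affine_minorants a f & (f 0)%:E = a 0.
Proof.
move=> a_gtNy a0_fin; pose A := fine (a 0).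
have [N aN] := a_superlin `|A|.
have [s sN] := mabs_ball_finite d N.
pose K := \sum_(beta <- s) `|A - fine (a beta)|.
have K0 : 0 <= K by apply: sumr_ge0.
exists (fun x => dotp (const_mx (- K)) x + A); last first.
  by rewrite dotp0r add0r fineK.
split=> [|beta]; first by exists (const_mx (- K)), A.
rewrite dotp_const_mi_vec; have [->|beta0] := eqVneq beta 0.
  have /eqP -> : mabs (0 : 'rV[nat]_d) == 0%N by rewrite mabs_eq0.
  by rewrite mulr0 add0r fineK.
have beta1 : 1 <= (mabs beta)%:R :> R by rewrite ler1n lt0n mabs_eq0.
have AK : - K * (mabs beta)%:R + A <= A - K by nra.
have [betaN|betaN] := leqP N (mabs beta).
  apply: le_trans (aN _ betaN); rewrite lee_fin.
  have := ler_norm A; have := normr_ge0 A; nra.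
case abeta : (a beta) => [r| |]; rewrite ?leey//; last first.
  by have := a_gtNy beta; rewrite abeta.
rewrite lee_fin; apply: le_trans AK _.
have := ler_term_sum (fun beta => normr_ge0 (A - fine (a beta))) (sN _ (ltnW betaN)).
by rewrite abeta /= -/K; have := ler_norm (A - r); lra.
Qed.

(** The function touches b at alpha and is below b on a large finite set of
    multi-indices, but may exceed b elsewhere: it stays below a there because
    its slope is bounded above, coordinatewise, independently of that set. *)
Lemma affine_minorant_touching_convex_seq (b : 'rV[nat]_d -> R) alpha :
  convex_seq b -> (forall beta, (b beta)%:E <= a beta)%E ->
  exists2 f, affine_minorants a f & f (mi_vec R alpha) = b alpha.
Proof.
move=> [G [Gconv Gb]] ba.
pose K := \sum_i `|b (mi_step alpha 1 i) - b alpha|.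
have [N aN] := a_superlin (K + `|b 0|).
have [s sN] := mabs_ball_finite d N.
pose s' := s ++ [seq mi_step alpha 1 i | i <- enum 'I_d].
have [|k kP] := finite_subgradient (s := [seq mi_vec R beta | beta <- s'])
  Gconv (orthant_mi_vec R alpha).
  by move=> _ /mapP[beta _ ->]; apply: orthant_mi_vec.
have {}kP beta : beta \in s' ->
    b alpha + dotp k (mi_vec R beta - mi_vec R alpha) <= b beta.
  by move=> sbeta; rewrite -!Gb; apply/kP/map_f.
(* Testing k at the neighbours of alpha bounds its coordinates from above. *)
have kK i : k 0 i <= K.
  have := kP (mi_step alpha 1 i); rewrite mem_cat map_f ?mem_enum ?orbT//.
  move=> /(_ isT); rewrite mi_vec_step scale1r addrAC subrr add0r dotp_deltar.
  have := @ler_term_sum R 'I_d (index_enum _)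
    (fun i => `|b (mi_step alpha 1 i) - b alpha|) i.
  move=> /(_ (fun=> normr_ge0 _) (mem_index_enum _)); rewrite -/K.
  have := ler_norm (b (mi_step alpha 1 i) - b alpha); lra.
(* The value at 0 of the affine function is at most b 0. *)
have sub0 : b alpha - dotp k (mi_vec R alpha) <= b 0.
  have := kP 0; rewrite mem_cat sN; last by rewrite (eqP (_ : mabs _ == 0%N)) ?mabs_eq0.
  by move=> /(_ isT); rewrite mi_vec0 sub0r dotpNr.
exists (fun x => dotp k x + (b alpha - dotp k (mi_vec R alpha))); last by ring.
split=> [|beta]; first by exists k, (b alpha - dotp k (mi_vec R alpha)).
have [betaN|betaN] := leqP (mabs beta) N.
  apply: le_trans (ba beta); rewrite lee_fin.
  by have := kP beta; rewrite mem_cat sN// dotpBr => /(_ isT); lra.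
apply: le_trans (aN _ (ltnW betaN)); rewrite lee_fin.
have beta1 : 1 <= (mabs beta)%:R :> R by rewrite ler1n (leq_trans _ betaN).
have := dotp_mi_vec_le beta kK; have := ler_norm (b 0); have := normr_ge0 (b 0).
nra.
Qed.

Lemma affine_envelope_ge f x :
  affine_minorants a f -> ((f x)%:E <= affine_envelope a x)%E.
Proof. by move=> af; apply: ereal_sup_ubound; exists f. Qed.

End Minorants.

(** * The affine envelope is the convex minorant *)

Section Envelope.
Variables (R : realType) (d : nat) (a : 'rV[nat]_d -> \bar R).
Hypothesis a_superlin : superlinear a.
Hypothesis a_gtNy : (forall alpha, -oo < a alpha)%E.
Hypothesis a_finite : finite_set [set alpha | a alpha = +oo%E].
Hypothesis a0_fin : a 0 \is a fin_num.

Lemma eventually_fin_num :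
  exists N, forall beta, (N <= mabs beta)%N -> a beta \is a fin_num.
Proof.
have [s sE] := (finite_seqP _).1 a_finite.
exists (\max_(beta <- s) mabs beta).+1 => beta betaN.
rewrite fin_real// a_gtNy ltey; apply/eqP => abeta.
have sbeta : beta \in s by have : [set` s] beta by rewrite -sE.
by have := leq_trans betaN (leq_bigmax_seq beta sbeta isT); rewrite ltnn.
Qed.

(** Far enough out, a is finite at the points M e_i, and for M >= x_1 + ... + x_d
    the point x lies in the simplex with vertices 0, M e_1, ..., M e_d; the
    values of a at these vertices bound every affine minorant at x. *)
Lemma affine_envelope_fin_num x :
  orthant R d x -> affine_envelope a x \is a fin_num.
Proof.
move=> x0; have [f0 af0 _] := affine_minorant_at0 a_superlin a_gtNy a0_fin.
rewrite fin_real//; apply/andP; split.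
  exact: lt_le_trans (ltNyr _) (affine_envelope_ge x af0).
have [N aN] := eventually_fin_num.
pose S := \sum_i x 0 i.
have S0 : 0 <= S by apply: sumr_ge0.
pose M := (maxn N (Num.bound S)).+1.
have M0 : 0 < M%:R :> R by rewrite ltr0n.
have SM : S <= M%:R.
  apply: le_trans (ltW (archi_boundP S0)) _.
  by rewrite ler_nat (leq_trans (leq_maxr N _)).
pose v i := fine (a (mi_step 0 M i)).
apply: le_lt_trans
  (ltry ((\sum_i x 0 i * v i + (M%:R - S) * fine (a 0)) / M%:R)).
apply: ge_ereal_sup => _ [f [[k [c fE]] fa] <-]; rewrite lee_fin ler_pdivlMr//.
have c_le : c <= fine (a 0).
  by rewrite -lee_fin fineK// (le_trans _ (fa 0))// mi_vec0 fE dotp0r add0r.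
have vertex_le i : M%:R * k 0 i + c <= v i.
  rewrite -lee_fin fineK; last first.
    by apply: aN; apply: leq_trans (leq_mabs_step _ _ _); rewrite ltnW// ltnS leq_maxl.
  by rewrite (le_trans _ (fa _))// mi_vec_step mi_vec0 add0r fE dotpZr dotp_deltar.
(* The barycentric coordinates of x, multiplied by M, are the x_i, and M - S
   for the vertex 0. *)
have -> : f x * M%:R = \sum_i x 0 i * (M%:R * k 0 i + c) + (M%:R - S) * c.
  under eq_bigr do rewrite mulrDr mulrCA (mulrC (x 0 _) (k _ _)).
  by rewrite big_split/= -mulr_sumr -mulr_suml -/S fE /dotp; ring.
apply: lerD; last by rewrite ler_wpM2l// subr_ge0.
by apply: ler_sum => i _; rewrite ler_wpM2l.
Qed.

Lemma affine_envelope_convex :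
  convex_function (orthant R d) (fun x => fine (affine_envelope a x)).
Proof.
move=> t x y; rewrite !inE => x0 y0; rewrite convRE.
pose z : 'rV[R]_d := t%:inum *: x + (1 - t%:inum) *: y.
rewrite -[X in affine_envelope a X]/z.
have t0 : 0 <= t%:inum by [].
have t1 : 0 <= 1 - t%:inum by rewrite subr_ge0.
have z0 : orthant R d z.
  by move=> i; rewrite !mxE addr_ge0// mulr_ge0.
rewrite -lee_fin fineK ?affine_envelope_fin_num//.
apply: ge_ereal_sup => _ [f af <-]; rewrite lee_fin.
have [[k [c fE]] _] := af.
have fle w : orthant R d w -> f w <= fine (affine_envelope a w).
  by move=> w0; rewrite -lee_fin fineK ?affine_envelope_fin_num// affine_envelope_ge.
have -> : f z = t%:inum * f x + (1 - t%:inum) * f y.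
  by rewrite !fE dotpDr !dotpZr; ring.
by apply: lerD; rewrite ler_wpM2l// fle.
Qed.

Lemma affine_envelope_minorant :
  is_convex_minorant a (fun alpha => fine (affine_envelope a (mi_vec R alpha))).
Proof.
split.
- exists (fun x => fine (affine_envelope a x)).
  by split=> //; apply: affine_envelope_convex.
- move=> alpha; rewrite fineK; last exact/affine_envelope_fin_num/orthant_mi_vec.
  by apply: ge_ereal_sup => _ [f [_ fa] <-].
- move=> b b_convex ba alpha.
  have [f af <-] := affine_minorant_touching_convex_seq a_superlin alpha b_convex ba.
  rewrite -lee_fin fineK ?affine_envelope_ge//.
  exact/affine_envelope_fin_num/orthant_mi_vec.
Qed.

End Envelope.

Lemma is_convex_minorant_unique (R : realType) (d : nat)
    (a : 'rV[nat]_d -> \bar R) c c' :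
  is_convex_minorant a c -> is_convex_minorant a c' -> c = c'.
Proof.
move=> [c1 c2 c3] [c1' c2' c3']; apply/funext => alpha.
by apply/le_anti; rewrite c3'//= c3.
Qed.

(** hinf a k is the best constant term for the slope k.  It may be -oo, and such
    k contribute -oo to the supremum; it is never +oo because a_0 is finite. *)
Lemma affine_envelope_hinf (R : realType) (d : nat)
    (a : 'rV[nat]_d -> \bar R) (x : 'rV[R]_d) : a 0 \is a fin_num ->
  affine_envelope a x =
    ereal_sup [set (dotp k x)%:E + hinf a k | k in [set: 'rV[R]_d]]%E.
Proof.
move=> a0_fin; apply/le_anti/andP; split.
  apply: ge_ereal_sup => _ [f [[k [c fE]] fa] <-].
  apply: (@le_trans _ _ ((dotp k x)%:E + hinf a k)%E).
    rewrite fE EFinD leeD2l//; apply: le_ereal_inf_tmp => _ [beta _ <-].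
    by rewrite leeBrDr// -EFinD addrC -fE.
  by apply: ereal_sup_ubound; exists k.
apply: ge_ereal_sup => _ [k _ <-].
have h_le beta : (hinf a k <= a beta - (dotp k (mi_vec R beta))%:E)%E.
  by apply: ereal_inf_lbound; exists beta.
case hk : (hinf a k) => [h| |].
- rewrite -EFinD; apply: (@affine_envelope_ge _ _ _ (fun y => dotp k y + h)).
  split=> [|beta]; first by exists k, h.
  by rewrite addrC EFinD -leeBrDr// -hk.
- by have := h_le 0; rewrite hk mi_vec0 dotp0r sube0 leye_eq => /eqP a0; rewrite a0 in a0_fin.
- by rewrite addeNy leNye.
Qed.

Local Open Scope ereal_scope.

Theorem corollary4p2 (R : realType) (d : nat) (a : 'rV[nat]_d -> \bar R)
    (d_ge1 : (1 <= d)%N)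
    (a_gtNy : forall alpha, -oo < a alpha)
    (a_superlinear :
       (fun alpha => a alpha / ((mabs alpha)%:R)%:E) @ mabs_infty d --> +oo)
    (a_finite : finite_set [set alpha | a alpha = +oo])
    (a0_fin : a 0%R \is a fin_num) :
  (exists c : 'rV[nat]_d -> R, is_convex_minorant a c) /\
  (forall c : 'rV[nat]_d -> R, is_convex_minorant a c ->
     [/\ forall alpha, (c alpha)%:E = affine_envelope a (mi_vec R alpha),
         forall alpha, (c alpha)%:E =
           ereal_sup [set (dotp k (mi_vec R alpha))%:E + hinf a k
                     | k in [set: 'rV[R]_d]] &
         (c 0%R)%:E = a 0%R]).
Proof.
have a_superlin := cvg_superlinear a_superlinear.
have F_min := affine_envelope_minorant a_superlin a_gtNy a_finite a0_fin.
split=> [|c c_min]; first by eexists; exact: F_min.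
have cE alpha : (c alpha)%:E = affine_envelope a (mi_vec R alpha).
  rewrite (is_convex_minorant_unique c_min F_min) fineK//.
  exact/affine_envelope_fin_num/orthant_mi_vec.
split=> [//|alpha|]; first by rewrite cE affine_envelope_hinf.
apply/le_anti/andP; split; first by have [_ ca _] := c_min.
have [f af <-] := affine_minorant_at0 a_superlin a_gtNy a0_fin.
by rewrite cE mi_vec0 affine_envelope_ge.
Qed.
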